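(* Let $p$ be an odd prime and let $G$ be a finite abelian $p$-group. Then $G$ is (isomorphic to) the group of units of a commutative ring if and only if $G$ is an elementary abelian $p$-group and $p$ is a Mersenne prime.
   Context: Rings have a multiplicative identity. A finite $p$-group is a finite group whose order is a power of $p$. An elementary abelian finite $p$-group is a finite group that is isomorphic to a finite direct product of cyclic groups of order $p$. A Mersenne prime is a prime of the form $2^n - 1$ for some positive integer $n$.
   Formalization: The group G is additionally assumed nontrivial: the trivial group is the group of units of the field with two elements and is elementary abelian for every p, so the claim fails for trivial G when p is not a Mersenne prime (e.g. p = 5). *)

(* Defs.v *)
From HB Require Import structures.
From mathcomp Require Import all_boot all_order all_algebra.
From mathcomp Require Import all_fingroup all_solvable mxabelem.

Set Implicit Arguments.
Unset Strict Implicit.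
Unset Printing Implicit Defensive.

Import GRing.Theory.
Local Open Scope ring_scope.

Definition is_mersenne_prime (p : nat) : Prop :=
  prime p /\ exists2 n : nat, (0 < n)%N & p = (2 ^ n - 1)%N.

(* GRing.unit needs a nonzero ring with a boolean unit test and a computed     *)
(* inverse; this covers every commutative ring, finite or infinite, and agrees *)
(* with GRing.unit when both make sense (is_unitP).                            *)
Definition is_unit (R : comPzRingType) (u : R) : Prop :=
  exists v : R, v * u = 1.

(* R may be infinite, so its units need not form a finGroupType, as \isog would *)
(* require: the isomorphism from G onto the units is spelled out as a function  *)
(* into R (values outside G are irrelevant; f 1 = 1 follows). For finite R this *)
(* is G \isog [set: {unit R}] (units_isogP).                                    *)
Definition isog_units (gT : finGroupType) (G : {group gT})
    (R : comPzRingType) : Prop :=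
  exists f : gT -> R,
    [/\ {in G &, {morph f : x y / (x * y)%g >-> x * y}},
        {in G &, injective f}
      & forall u : R, is_unit u <-> exists2 x : gT, x \in G & f x = u].

Lemma is_unitP (R : comUnitRingType) (u : R) :
  is_unit u <-> u \is a GRing.unit.
Proof.
split=> [[v vu1]|Uu]; last by exists u^-1; rewrite mulVr.
by apply/unitrP; exists v; rewrite vu1 mulrC.
Qed.

Lemma units_isogP (gT : finGroupType) (G : {group gT})
    (R : finComUnitRingType) :
  isog_units G R <-> G \isog [set: {unit R}].
Proof.
split=> [[f [fM f_inj fU]]|].
  have Uf x : x \in G -> f x \is a GRing.unit.
    by move=> Gx; apply/is_unitP/fU; exists x.
  pose g (x : gT) : {unit R} := insubd (1%g : {unit R}) (f x).
  have valg x : x \in G -> val (g x) = f x.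
    by move=> Gx; rewrite val_insubd Uf.
  have gM : {in G &, {morph g : x y / (x * y)%g}}.
    move=> x y Gx Gy; apply: val_inj.
    by rewrite FinRing.val_unitM !valg ?groupM // fM.
  apply/isogP; exists (Morphism gM).
    apply/injmP=> x y Gx Gy /= /(congr1 val).
    by rewrite !valg // => /f_inj->.
  apply/setP=> u; rewrite inE morphimEdom /=.
  have /is_unitP/fU[x Gx fx] := valP u.
  by apply/imsetP; exists x; rewrite // -[LHS]/u; apply: val_inj; rewrite /= valg.
case/isogP=> g /injmP g_inj gT_im; exists (fun x => val (g x)); split.
- by move=> x y Gx Gy; rewrite morphM.
- by move=> x y Gx Gy /val_inj; apply: g_inj.
move=> u; split=> [/is_unitP Uu|[x _ <-]]; last exact/is_unitP/valP.
have: FinRing.Unit Uu \in (g @* G)%g by rewrite gT_im inE.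
by case/morphimP=> x _ Gx gx; exists x; rewrite // -gx.
Qed.

(* p.-abelem is defined by the exponent; this recovers direct products of       *)
(* copies of the cyclic group of order p (here the additive group of 'F_p).     *)
Lemma abelem_isog_prodP (p : nat) (gT : finGroupType) (G : {group gT}) :
  prime p ->
  (p.-abelem G)%g <-> exists n : nat, G \isog [set: 'rV['F_p]_n].
Proof.
move=> p_pr; split=> [abG|[n isoG]].
  exists (logn p #|G|); rewrite (isog_abelem_card _ abG).
  rewrite mx_Fp_abelem //= cardsT card_mx card_Fp // mul1n.
  by rewrite -(card_pgroup (abelem_pgroup abG)).
by rewrite (isog_abelem isoG) mx_Fp_abelem.
Qed.

(* The trivial group, which is p.-abelem for every p, is the unit group of 'F_2; *)
(* hence the unit-group criterion is only meaningful for nontrivial p-groups.    *)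
Lemma isog_units_trivial (gT : finGroupType) :
  isog_units (1%G : {group gT}) 'F_2.
Proof.
exists (fun=> 1); split=> [x y _ _|x y /set1P-> /set1P->|u] //.
  by rewrite mulr1.
split=> [/is_unitP|[x _ <-]]; last by exists 1; rewrite mulr1.
rewrite unitfE => u_neq0; exists 1%g => //; apply/eqP; move: u_neq0; case: u => [[|[|u]]] //.
Qed.

(* Main.v *)
Require Import Defs.
From HB Require Import structures.
From mathcomp Require Import all_boot all_order all_algebra.
From mathcomp Require Import all_fingroup all_solvable.
From mathcomp Require Import all_field ring zify.

(* Suppose that G, of odd order p^n, is the group of units of R. Then -1 has    *)
(* odd order, so R has characteristic 2 and every unit u gives a morphism       *)
(* phi : F_2[X] -> R with phi 'X = u. When u has order p^(k+1), some            *)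
(* irreducible q dividing ('X^(p^(k+1)) - 1) / ('X^(p^k) - 1) survives in the   *)
(* image of phi. As 'X^(p^(k+1)) - 1 is separable, the Chinese remainder        *)
(* theorem lifts every nonzero element of the field K = F_2[X] / q to a unit of *)
(* R, so the order 2^d - 1 of the cyclic group K^* divides p^n. An elementary   *)
(* computation shows that 2^d - 1 = p^j forces j = 1, hence k = 0 and p is      *)
(* Mersenne. Conversely, if p = 2^n - 1 then the units of a power of the field  *)
(* of order 2^n form an elementary abelian p-group.                             *)

(** The kernel of phi is unknown, so K need not be given as a quotient of the image of phi. Instead
    [local_factor] supplies h with phi h nonzero and phi (q * h) zero, and [card_local_factor]
    derives from it that 2^d - 1 divides p^n. Thus 2^d - 1 = p^j; as q divides 'X^(p^j) - 1 but is
    prime to 'X^(p^k) - 1, k < j, and [pow_eq_pred_pow2] gives j = 1. The converse is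
    [abelem_isog_units]. *)

Set Implicit Arguments.
Unset Strict Implicit.
Unset Printing Implicit Defensive.
Import GRing.Theory.
Local Open Scope ring_scope.

(* If j is odd then p ^ j + 1 is an odd multiple of p + 1, and if j is even it *)
(* is 2 modulo 4.                                                              *)
Lemma pow_eq_pred_pow2 (p d j : nat) :
  odd p -> (0 < j)%N -> (p ^ j)%N = (2 ^ d).-1 -> p = (2 ^ d).-1.
Proof.
move=> p_odd j_gt0 pj.
have pj1 : ((p ^ j).+1 = 2 ^ d)%N by rewrite pj prednK // expn_gt0.
have Dp : p = (2 * p./2 + 1)%N by rewrite -{1}[p]odd_double_half p_odd; lia.
have [j_odd|j_even] := boolP (odd j).
  (* The witness comes from p ^ 2 - 1 = (p - 1) * (p + 1), where p - 1 = 2 * p./2. *)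
  have [t Dt] : exists t, ((p ^ 2) ^ j./2 = 1 + 2 * (p + 1) * t)%N.
    elim: (j./2) => [|i [t IHi]]; first by exists 0%N; rewrite muln0.
    exists (p./2 + p ^ 2 * t)%N; rewrite expnS IHi -mulnn; nia.
  have {}pj1 : (2 ^ d = (p + 1) * (2 * p * t).+1)%N.
    rewrite -pj1 -[j]odd_double_half j_odd -mul2n expnD expnM Dt expn1; lia.
  have Q1 : (2 * p * t).+1 = 1%N.
    have co_Q : coprime (2 * p * t).+1 (2 ^ d).
      by rewrite coprimeXr // coprimen2 /= -mulnA mul2n odd_double.
    by move/eqP: co_Q; rewrite pj1 (gcdn_idPl (dvdn_mull _ _)).
  by rewrite pj1 Q1; lia.
have: odd (p ^ j./2) by rewrite oddX p_odd orbT.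
move: pj1; rewrite -{1}[j]odd_double_half (negPf j_even) add0n -muln2 expnM.
move: (p ^ j./2)%N => a Da a_odd; have {}Dp : a = (2 * a./2 + 1)%N.
  by rewrite -{1}[a]odd_double_half a_odd; lia.
(* Only d = 1 survives: p is not assumed prime here, and p = 1 satisfies the conclusion. *)
case: d => [|[|d]] in pj Da *; first by case: a a_odd {Dp} Da.
  have /eqP : (p ^ j = 1 ^ j)%N by rewrite pj exp1n.
  by rewrite eqn_exp2r // => /eqP->.
by move: Da Dp; rewrite !expnS expn0 !muln1; move: (2 ^ d)%N => D; nia.
Qed.

Lemma irreducible_factor (F : finFieldType) (p : {poly F}) :
  (1 < size p)%N -> exists2 q, monic_irreducible_poly q & q %| p.
Proof.
move: {2}(size p) (leqnn (size p)) => n; elim: n p => [|n IHn] p.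
  by rewrite leqn0 => /eqP->.
move=> sp p_gt1; have p_neq0 : p != 0 by rewrite -size_poly_gt0 ltnW.
have [/irreducibleP p_irr|] := boolP (irreducibleb p).
  exists ((lead_coef p)^-1 *: p); last by rewrite dvdpZl ?invr_eq0 ?lead_coef_eq0.
  have eqp : (lead_coef p)^-1 *: p %= p.
    by rewrite eqp_scale ?invr_eq0 ?lead_coef_eq0.
  split.
    split; first by rewrite (eqp_size eqp).
    move=> q sq; rewrite (eqp_dvdr _ eqp) => /(p_irr.2 _ sq) /eqp_trans-> //.
    by rewrite eqp_sym.
  by rewrite monicE lead_coefZ mulVf ?lead_coef_eq0.
(* Irreducibility over a finite field is a finite search, so its failure yields a nonconstant
   divisor of smaller size. *)
rewrite /irreducibleb p_gt1 /= => /forallPn[/= q].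
rewrite negb_imply -ltnNge -dvdpE => /andP[qp sq].
have [|r r_irr rq] := IHn q _ sq.
  rewrite -ltnS; apply: leq_trans sp; apply: leq_ltn_trans (size_npoly q) _.
  by rewrite prednK // ltnW.
by exists r => //; apply: dvdp_trans qp.
Qed.

Lemma in_qpoly_eq0 (F : fieldType) (q f : {poly F}) :
  monic_irreducible_poly q -> (in_qpoly q f == 0) = (q %| f).
Proof.
move=> q_irr.
by rewrite -val_eqE /= mk_monicE // -Pdiv.IdomainMonic.modpE ?q_irr.2.
Qed.

Section LocalFactor.

Variables (F : finFieldType) (R : comPzRingType).
Variable phi : {rmorphism {poly F} -> R}.

(* The multiples of phi h form a nonzero vector space over {poly F} / q: this   *)
(* is how q survives in the image of phi without computing the kernel of phi.  *)
Lemma local_factor (g b : {poly F}) :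
  g != 0 -> phi (g * b) = 0 -> phi b != 0 ->
  exists q h : {poly F}, [/\ monic_irreducible_poly q, q %| g,
    q * h %| g * b, phi (q * h) = 0 & phi h != 0].
Proof.
move: {2}(size g) (leqnn (size g)) => n; elim: n g => [|n IHn] g.
  by rewrite leqn0 size_poly_eq0 => /eqP->; rewrite eqxx.
move=> sg g_neq0 gb0 b_neq0.
have [|g_gt1] := leqP (size g) 1.
  move=> /size1_polyC g_const; case/eqP: b_neq0.
  have c_neq0 : g`_0 != 0 by rewrite -polyC_eq0 -g_const.
  rewrite -[b]mul1r -[1]/(1%:P) -(mulVf c_neq0) polyCM -g_const -mulrA.
  by rewrite rmorphM gb0 mulr0.
have [q q_irr qg] := irreducible_factor g_gt1.
have [g' Dg] := dvdpP _ _ qg; rewrite mulrC in Dg.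
(* Irreducible factors are stripped off g until the remaining multiple of b is no longer killed by
   phi; the last one stripped is q. *)
have [g'b0|g'b_neq0] := eqVneq (phi (g' * b)) 0; last first.
  by exists q, (g' * b); rewrite mulrA -Dg.
have g'_neq0 : g' != 0 by apply: contraNneq g_neq0 => g'0; rewrite Dg g'0 mulr0.
have [|q1 [h [? q1g ? ? ?]]] := IHn g' _ g'_neq0 g'b0 b_neq0.
  rewrite -ltnS; apply: leq_trans sg.
  have [[q_gt1 _] _] := q_irr; rewrite Dg size_mul ?(irredp_neq0 q_irr.1) //.
  by case: (size q) q_gt1 => [|[|k]] // _; rewrite !addSn /= ltnS leq_addl.
exists q1, h; split=> //; first by rewrite Dg dvdp_mull.
by rewrite Dg -mulrA dvdp_mull.
Qed.

(** With a * q + b * h = 1, b * h is idempotent modulo q * h. A nonzero x of K is lifted to a unit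
    equal to x modulo q and to 1 modulo h. *)
Lemma card_local_factor (q h : {poly F}) (m : nat) :
  monic_irreducible_poly q -> coprimep q h ->
  phi (q * h) = 0 -> phi h != 0 ->
  (forall v : R, is_unit v -> v ^+ m = 1) ->
  ((#|F| ^ (size q).-1).-1 %| m)%N.
Proof.
move=> q_irr /Bezout_eq1_coprimepP[[a b] /= ab1] qh0 h_neq0 Um.
pose K : finFieldType := {poly %/ q with q_irr}.
have expK (x : K) : x != 0 -> x ^+ m = 1.
  move=> x_neq0.
  pose y : {poly F} := (x : {poly %/ q}).
  have /Bezout_eq1_coprimepP[[d c] /= cd1] : coprimep q y.
    by have := coprimep_unit q_irr x_neq0; rewrite -/y mk_monicE.
  pose f : {poly F} := y * (b * h) + a * q.
  have Uf : is_unit (phi f).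
    exists (phi (c * (b * h) + a * q)); rewrite -rmorphM.
    (* Modulo q * h this is (a * q + b * h) ^+ 2, because c * y = 1 - d * q. *)
    have -> : (c * (b * h) + a * q) * f =
        (a * q + b * h) ^+ 2 + (d * q + c * y - 1) * (b * h) ^+ 2
        + (q * h) * ((y + c - 2%:R) * a * b - d * b ^+ 2 * h).
      by rewrite /f; ring.
    rewrite ab1 cd1 subrr mul0r addr0 expr1n.
    by rewrite rmorphD rmorphM rmorph1 qh0 mul0r addr0.
  (* Both phi q and phi (f ^+ m - 1) annihilate phi h, so coprimality would make phi h vanish. *)
  have q_fm : q %| f ^+ m - 1.
    apply/negPn/negP; rewrite -(irreducible_poly_coprime _ q_irr.1).
    case/Bezout_eq1_coprimepP=> -[a' b'] /= ab'1; case/eqP: h_neq0.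
    rewrite -[h]mul1r -ab'1 mulrDl -mulrA rmorphD !rmorphM /= -rmorphM qh0.
    by rewrite rmorphB rmorphXn /= Um // rmorph1 subrr !(mulr0, mul0r) addr0.
  have fx : in_qpoly q f = x.
    have -> : f = q * (a - y * a) + (a * q + b * h) * y.
      by rewrite /f; ring.
    rewrite ab1 mul1r rmorphD /=.
    have /eqP-> : in_qpoly q (q * (a - y * a)) == 0.
      by rewrite in_qpoly_eq0 // dvdp_mulIl.
    rewrite add0r; apply/val_inj/in_qpoly_small.
    exact: size_mk_monic.
  move: q_fm; rewrite -(in_qpoly_eq0 _ q_irr) rmorphB rmorphXn rmorph1 /= fx.
  by rewrite subr_eq0 => /eqP.
have /cyclicP[g Dg] := field_unit_group_cyclic [set: {unit K}].
have := card_finField_unit K; rewrite card_qfpoly Dg => <-.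
rewrite order_dvdn; apply/eqP/val_inj; rewrite FinRing.val_unitX expK //.
by rewrite -unitfE (valP g).
Qed.

End LocalFactor.

(** The class of 'X in K is nonzero because a positive power of it is 1, so Fermat's theorem in K
    applies. *)
Lemma dvdp_Xn_card_sub_1 (F : finFieldType) (q : {poly F}) (n : nat) :
  monic_irreducible_poly q -> (0 < n)%N -> q %| 'X^n - 1 ->
  q %| 'X^((#|F| ^ (size q).-1).-1) - 1.
Proof.
move=> q_irr n_gt0 q_n; pose K : finFieldType := {poly %/ q with q_irr}.
pose x : K := in_qpoly q 'X.
have dvd_x m : (q %| 'X^m - 1) = (x ^+ m == 1).
  by rewrite -(in_qpoly_eq0 _ q_irr) rmorphB rmorphXn rmorph1 subr_eq0.
have x_neq0 : x != 0.
  apply/eqP=> x0; move: q_n; rewrite dvd_x x0 expr0n eqn0Ngt n_gt0 /=.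
  by rewrite eq_sym oner_eq0.
rewrite dvd_x -(card_qfpoly q_irr); apply/eqP/(mulfI x_neq0).
by rewrite mulr1 -exprS prednK ?expf_card //; apply/card_gt0P; exists x.
Qed.

Lemma pgroup_units_mersenne (R : comNzRingType) (p k n : nat) (u : R) :
  2 \in [pchar R] -> prime p -> odd p ->
  u ^+ (p ^ k.+1) = 1 -> u ^+ (p ^ k) != 1 ->
  (forall v : R, is_unit v -> v ^+ (p ^ n) = 1) ->
  k = 0%N /\ is_mersenne_prime p.
Proof.
move=> char2 p_pr p_odd uk1 uk Un.
have p_gt0 := prime_gt0 p_pr; have p_gt1 := prime_gt1 p_pr.
pose phi := @horner_alg 'F_2 (pPrimeCharType char2) u.
have phiE m : phi ('X^m - 1) = u ^+ m - 1.
  by rewrite /phi rmorphB rmorphXn rmorph1 /= horner_algX.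
pose b : {poly 'F_2} := 'X^(p ^ k) - 1.
have [g Dg] : exists g, 'X^(p ^ k.+1) - 1 = g * b.
  apply/dvdpP; rewrite expnSr exprM -[X in _ %| _ - X](expr1n _ p).
  by rewrite subrXX dvdp_mulIl.
have P_neq0 : 'X^(p ^ k.+1) - 1 != 0 :> {poly 'F_2}.
  by rewrite -size_poly_eq0 size_XnsubC ?expn_gt0 ?p_gt0.
have sepP : separable_poly (g * b).
  rewrite -Dg cyclotomic.separable_Xn_sub_1 //.
  rewrite -(dvdn_pcharf (pchar_Fp (isT : prime 2))) dvdn2 oddX.
  by rewrite p_odd orbT.
have g_neq0 : g != 0 by apply: contraNneq P_neq0 => g0; rewrite Dg g0 mul0r.
have gb0 : phi (g * b) = 0 by rewrite -Dg phiE uk1 subrr.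
have b_neq0 : phi b != 0 by rewrite phiE subr_eq0.
have [q [h [q_irr qg qh_gb qh0 h_neq0]]] := local_factor g_neq0 gb0 b_neq0.
have co_qh : coprimep q h.
  by have := dvdp_separable qh_gb sepP; rewrite separable_mul => /and3P[].
have co_qb : coprimep q b.
  move: sepP; rewrite separable_mul => /and3P[_ _].
  exact: coprimep_dvdr.
have q_card : q %| 'X^((#|'F_2| ^ (size q).-1).-1) - 1.
  apply: (dvdp_Xn_card_sub_1 q_irr (n := p ^ k.+1)).
    by rewrite expn_gt0 p_gt0.
  by rewrite Dg dvdp_mulr.
have := card_local_factor q_irr co_qh qh0 h_neq0 Un.
rewrite card_Fp // in q_card *; set d := (size q).-1 in q_card *.
case/(dvdn_pfactor _ _ p_pr) => j _ Dj.
(* If j <= k, then 'X^(p^j) - 1 divides b, and so does q, which is coprime to b. *)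
have k_lt_j : (k < j)%N.
  rewrite ltnNge; apply/negP=> j_le_k.
  have q_b : q %| b.
    apply: dvdp_trans q_card _; rewrite Dj /b -(subnKC j_le_k) expnD exprM.
    by rewrite -[X in _ %| _ - X](expr1n _ (p ^ (k - j))) subrXX dvdp_mulIl.
  have := coprimepP _ _ co_qb q (dvdpp q) q_b.
  by rewrite -size_poly_eq1 => /eqP q1; have := q_irr.1.1; rewrite q1.
have Dp : p = (2 ^ d).-1.
  by apply: pow_eq_pred_pow2 (esym Dj) => //; apply: leq_ltn_trans k_lt_j.
have j1 : j = 1%N.
  by apply/eqP; rewrite -(eqn_exp2l _ _ p_gt1) -Dj -Dp expn1.
split; first by move: k_lt_j; rewrite j1 ltnS leqn0 => /eqP.
split=> //; exists d; last by rewrite subn1.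
by case: (d) Dp p_gt1 => // ->.
Qed.

HB.instance Definition _ (aT : finType) (R : comPzRingType) :=
  GRing.PzRing_hasCommutativeMul.Build {ffun aT -> R} (@ffun_mulC aT R).

(** The group F^* is cyclic of order p; raising a generator z to the coordinates of a vector over
    'F_p identifies G with the units of a power of F. *)
Lemma abelem_isog_units (F : finFieldType) (gT : finGroupType) (G : {group gT}) :
  prime #|F|.-1 -> (#|F|.-1.-abelem G)%g -> exists R : comPzRingType, isog_units G R.
Proof.
set p := #|F|.-1 => p_pr abG.
have [n /isogP[phi /injmP phi_inj phiG]] := (abelem_isog_prodP G p_pr).1 abG.
have /cyclicP[z Dz] := field_unit_group_cyclic [set: {unit F}].
have oz : #[z]%g = p by rewrite orderE -Dz card_finField_unit.
pose f x : {ffun 'I_n -> F} := [ffun i => val z ^+ (phi x 0 i : nat)].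
have f_expg x i : f x i = val (z ^+ (phi x 0 i : nat))%g.
  by rewrite ffunE FinRing.val_unitX.
(* Addition in 'F_p reduces modulo [(Zp_trunc (pdiv p)).+2], which equals p only by [Fp_cast]. *)
have modF m : m %% (Zp_trunc (pdiv p)).+2 = m %[mod p].
  by rewrite (Fp_cast p_pr) modn_mod.
have ltF (a : 'F_p) : (a < p)%N by rewrite -{2}(Fp_cast p_pr).
exists {ffun 'I_n -> F}, f; split.
- move=> x y Gx Gy; apply/ffunP=> i.
  rewrite [RHS]ffunE !f_expg -FinRing.val_unitM -expgD; congr val.
  rewrite morphM // mxE /=; apply/eqP; rewrite eq_expg_mod_order oz.
  by apply/eqP/modF.
- move=> x y Gx Gy fxy; apply: phi_inj => //; apply/rowP=> i.
  have /ffunP/(_ i) := fxy; rewrite !f_expg => /val_inj/eqP.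
  rewrite eq_expg_mod_order oz => /eqP xy_i; apply/val_inj.
  by rewrite !modn_small ?ltF in xy_i.
move=> u; split=> [[v vu1]|[x _ <-]]; last first.
  exists [ffun i => (f x i)^-1]; apply/ffunP=> i.
  by rewrite !ffunE mulVf // expf_neq0 // -unitfE (valP z).
have Uu i : u i \is a GRing.unit.
  apply/unitrPr; exists (v i); rewrite mulrC.
  by have /ffunP/(_ i) := vu1; rewrite !ffunE.
have log i : exists m : nat, u i == val (z ^+ m)%g.
  have : FinRing.unit F (Uu i) \in <[z]>%g by rewrite -Dz inE.
  by case/cycleP=> m Dm; exists m; rewrite -Dm.
pose w : 'rV['F_p]_n := \row_i (xchoose (log i))%:R.
have : w \in (phi @* G)%g by rewrite phiG inE.
case/morphimP=> x _ Gx Dw; exists x => //; apply/ffunP=> i.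
rewrite f_expg (eqP (xchooseP (log i))) -Dw mxE; congr val.
by apply/eqP; rewrite eq_expg_mod_order oz val_Fp_nat // modn_mod.
Qed.

Theorem corollary4 (p : nat) (gT : finGroupType) (G : {group gT})
    (p_prime : prime p) (p_odd : odd p)
    (G_nontrivial : G :!=: 1%g) (G_abelian : abelian G) (G_pgroup : (p.-group G)%g) :
  (exists R : comPzRingType, isog_units G R) <->
  ((p.-abelem G)%g /\ is_mersenne_prime p).
Proof.
split=> [[R [f [fM f_inj fU]]]|[abG [_ [n n_gt0 Dp]]]]; last first.
  have [F _ oF] := pPrimePowerField (isT : prime 2) n_gt0.
  have DF : p = #|F|.-1 by rewrite oF -subn1.
  by apply: (@abelem_isog_units F); rewrite -DF.
have f1 : f 1%g = 1.
  have [v vf1] : is_unit (f 1%g) by apply/fU; exists 1%g.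
  by rewrite -[LHS]mul1r -{1}vf1 -mulrA -fM ?group1 // mulg1.
have fX x m : x \in G -> f (x ^+ m)%g = f x ^+ m.
  move=> Gx; elim: m => [|m IHm]; first by rewrite expg0.
  by rewrite expgS fM ?groupX // IHm exprS.
(* The zero ring has a single element, which would make G trivial. *)
have ne10 : (1 : R) != 0.
  apply: contraNneq G_nontrivial => R0; apply/eqP/trivgP/subsetP=> x Gx.
  by apply/set1P/f_inj; rewrite // -[f x]mul1r -[f 1%g]mul1r R0 !mul0r.
have [n oG] := p_natP G_pgroup.
have Un (v : R) : is_unit v -> v ^+ (p ^ n) = 1.
  by move/fU=> [x Gx <-]; rewrite -fX // -oG expg_cardG.
have two0 : 2%:R = 0 :> R.
  have /Un : is_unit (-1 : R) by exists (-1); rewrite mulrNN mulr1.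
  rewrite -signr_odd oddX p_odd orbT expr1 => N1.
  by rewrite -[2]/(1 + 1) -{2}N1 subrr.
pose R' : comNzRingType := HB.pack R (GRing.PzSemiRing_isNonZero.Build R ne10).
have char2 : 2 \in [pchar R'] by rewrite inE; apply/andP; split=> //; apply/eqP.
have key x : x \in G -> x != 1%g -> (x ^+ p)%g = 1%g /\ is_mersenne_prime p.
  move=> Gx x_neq1.
  have [k ox] := p_natP (mem_p_elt G_pgroup Gx).
  case: k ox => [/eqP|k ox]; first by rewrite order_eq1 (negPf x_neq1).
  have [||k0 mp] := @pgroup_units_mersenne R' p k n (f x) char2 p_prime p_odd _ _ Un.
  - by rewrite -[LHS](fX x) // -ox expg_order.
  - apply/eqP=> fxk.
    have : (x ^+ (p ^ k) = 1)%g by apply: f_inj; rewrite ?groupX // f1 fX.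
    by move/eqP; rewrite -order_dvdn ox dvdn_Pexp2l ?prime_gt1 // ltnn.
  by split=> //; move: ox; rewrite k0 expn1 => <-; rewrite expg_order.
have [x Gx x_neq1] := trivgPn _ G_nontrivial.
split; last by have [] := key x Gx x_neq1.
rewrite abelemE // G_abelian; apply/exponentP=> y Gy.
by have [->|/(key y Gy)[]//] := eqVneq y 1%g; rewrite expg1n.
Qed.
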